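(* Let $T_0$ be a theory and let $T$ be the smallest closed theory which contains $T_0$, $\mathbf{V}$ and $\mathbf{K}$ and which has the property that $\varphi\in T$ whenever $T\models\varphi$. If $T_0$ is generic then $T$ is generic; and if $T_0$ is closed generic then $T$ is closed generic.
   Context: Fix a nonempty set of symbols called propositional atoms and a symbol $\mathrm{K}$ which is not a propositional atom. Formulas are defined recursively: every propositional atom is a formula; if $\varphi,\psi$ are formulas then so are $\neg\varphi$, $(\varphi\wedge\psi)$, $(\varphi\vee\psi)$, $(\varphi\rightarrow\psi)$; if $\varphi$ is a formula then so is $\mathrm{K}(\varphi)$. A formula is basic if it is a propositional atom or of the form $\mathrm{K}\varphi$. A theory is a set of formulas. A model is a function assigning a truth value to every basic formula; truth $\mathscr M\models\varphi$ of an arbitrary formula is defined from the values of basic formulas by the classical truth tables (formulas $\mathrm{K}\varphi$ are treated like atoms). $\mathscr M\models T$ means $\mathscr M\models\varphi$ for all $\varphi\in T$; $T\models\varphi$ means every model of $T$ satisfies $\varphi$; $\varphi$ is valid if $\emptyset\models\varphi$. A theory $T$ is closed if $\varphi\in T$ implies $\mathrm{K}\varphi\in T$. $\mathbf{V}=\{\mathrm{K}\varphi:\varphi\text{ valid}\}$; $\mathbf{K}=\{\mathrm{K}(\varphi\rightarrow\psi)\rightarrow(\mathrm{K}\varphi\rightarrow\mathrm{K}\psi)\}$ (all formulas of this form). For a theory $T$ and a set $S$ of propositional atoms, $\mathscr M_{T,S}$ is the model with $\mathscr M_{T,S}\models p$ iff $p\in S$ for atoms $p$, and $\mathscr M_{T,S}\models\mathrm{K}\varphi$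 iff $T\models\varphi$. A theory $T$ is generic if for every set $S$ of propositional atoms and every theory $T'\supseteq T$, $\mathscr M_{T',S}\models T$; $T$ is closed generic if for every set $S$ of propositional atoms and every closed theory $T'\supseteq T$, $\mathscr M_{T',S}\models T$. *)

(* Defs.v *)
From mathcomp Require Import all_boot.
From mathcomp Require Import boolp classical_sets.

Set Implicit Arguments.
Unset Strict Implicit.
Unset Printing Implicit Defensive.

Local Open Scope classical_set_scope.

(* [A] is the set of propositional atoms, [Know phi] is the formula K(phi). *)
Inductive formula (A : Type) : Type :=
| Atom of A
| Neg of formula A
| And of formula A & formula A
| Or of formula A & formula A
| Imp of formula A & formula A
| Know of formula A.

Definition is_basic (A : Type) (phi : formula A) : bool :=
  match phi with Atom _ | Know _ => true | _ => false end.

Definition theory (A : Type) : Type := set (formula A).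

Definition model (A : Type) : Type := {phi : formula A | is_basic phi} -> bool.

Fixpoint truth (A : Type) (M : model A) (phi : formula A) : bool :=
  match phi with
  | Atom p => M (exist _ (Atom p) isT)
  | Neg psi => ~~ truth M psi
  | And psi chi => truth M psi && truth M chi
  | Or psi chi => truth M psi || truth M chi
  | Imp psi chi => truth M psi ==> truth M chi
  | Know psi => M (exist _ (Know psi) isT)
  end.

Definition models_theory (A : Type) (M : model A) (T : theory A) : Prop :=
  forall phi, T phi -> truth M phi.

Definition entails (A : Type) (T : theory A) (phi : formula A) : Prop :=
  forall M : model A, models_theory M T -> truth M phi.

Definition valid (A : Type) (phi : formula A) : Prop := entails set0 phi.

Definition closed_theory (A : Type) (T : theory A) : Prop :=
  forall phi, T phi -> T (Know phi).

Definition entailment_closed (A : Type) (T : theory A) : Prop :=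
  forall phi, entails T phi -> T phi.

Definition axiomsV (A : Type) : theory A :=
  [set chi | exists2 phi, valid phi & chi = Know phi].

Definition axiomsK (A : Type) : theory A :=
  [set chi | exists phi psi : formula A,
     chi = Imp (Know (Imp phi psi)) (Imp (Know phi) (Know psi))].

(* The default branch is never reached, as the argument is basic. *)
Definition canonical_model (A : Type) (T : theory A) (S : set A) : model A :=
  fun b => match sval b with
           | Atom p => `[< S p >]
           | Know phi => `[< entails T phi >]
           | _ => false
           end.

Definition generic (A : Type) (T : theory A) : Prop :=
  forall (S : set A) (T' : theory A),
    T `<=` T' -> models_theory (canonical_model T' S) T.

Definition closed_generic (A : Type) (T : theory A) : Prop :=
  forall (S : set A) (T' : theory A),
    closed_theory T' -> T `<=` T' -> models_theory (canonical_model T' S) T.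

(* [smallest C G] is the intersection of all sets that satisfy [C] and
   contain [G]; both closure conditions below are stable under intersection
   and hold of the set of all formulas, so the closure is itself such a set. *)
Definition theory_closure (A : Type) (T0 : theory A) : theory A :=
  smallest (fun T => closed_theory T /\ entailment_closed T)
           (T0 `|` @axiomsV A `|` @axiomsK A).

(* Main.v *)
(* Fix [T' ⊇ T] and [S].  The set of members of [T] true in [M_{T',S}] contains
   [T0] (by genericity), [V] and [K], is closed because everything in [T'] is
   known in [M_{T',S}], and is entailment-closed because truth in a fixed model
   is; hence it is all of [T]. *)
Require Import Defs.
From mathcomp Require Import all_boot.
From mathcomp Require Import boolp classical_sets.

Local Open Scope classical_set_scope.

Lemma entails_mono (A : Type) (T T' : theory A) (phi : formula A) :
  T `<=` T' -> entails T phi -> entails T' phi.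
Proof. by move=> TT' Tphi M MT'; apply: Tphi => psi /TT' /MT'. Qed.

Lemma mem_entails (A : Type) (T : theory A) (phi : formula A) :
  T phi -> entails T phi.
Proof. by move=> Tphi M; exact. Qed.

Lemma entails_mp (A : Type) (T : theory A) (phi psi : formula A) :
  entails T (Imp phi psi) -> entails T phi -> entails T psi.
Proof. by move=> Ti Tphi M MT; exact: implyP (Ti M MT) (Tphi M MT). Qed.

Lemma theory_closure_closed (A : Type) (T0 : theory A) :
  closed_theory (theory_closure T0).
Proof. by move=> phi Tphi X XP; apply: XP.1.1; exact: Tphi. Qed.

(** The closure lies inside each [X] of the intersection, so by monotonicity what it entails is
    entailed by [X], hence in [X]. *)
Lemma theory_closure_entailment_closed (A : Type) (T0 : theory A) :
  entailment_closed (theory_closure T0).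
Proof.
move=> phi Tphi X XP; apply: XP.1.2; apply: entails_mono Tphi => psi.
exact.
Qed.

Lemma sub_theory_closure (A : Type) (T0 : theory A) :
  T0 `<=` theory_closure T0.
Proof. by move=> phi T0phi; apply: sub_gen_smallest; left; left. Qed.

(** Common core of both halves: either kind of genericity enters only as truth of [T0] in this one
    model. *)
Lemma canonical_model_theory_closure (A : Type) (T0 T' : theory A) (S : set A) :
  theory_closure T0 `<=` T' -> models_theory (canonical_model T' S) T0 ->
  models_theory (canonical_model T' S) (theory_closure T0).
Proof.
move=> TT' MT0; set M := canonical_model T' S.
(* Truth of [phi] in [M] alone does not give truth of [Know phi]; membership in the closure, hence
   in [T'], does. *)
suff TM : theory_closure T0 `<=` theory_closure T0 `&` [set phi | truth M phi].
  by move=> phi /TM[].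
apply: smallest_sub; first split.
- move=> phi [Tphi _]; split; first exact: theory_closure_closed.
  by apply/asboolP/mem_entails/TT'.
(* [M] is itself a model of the intersection, so the entailment can be evaluated at [M]. *)
- move=> phi TMphi; split; last by apply: TMphi => psi [].
  apply: theory_closure_entailment_closed; apply: entails_mono TMphi.
  exact: subIsetl.
- move=> phi genphi; split; first exact: sub_gen_smallest.
  case: genphi => [[/MT0 //|[psi vpsi ->]]|[psi [chi ->]]].
    by apply/asboolP; exact: entails_mono vpsi.
  (* In [M], an instance of [axiomsK] says that entailment from [T'] respects modus ponens. *)
  apply/implyP => /asboolP Ti; apply/implyP => /asboolP Tpsi.
  by apply/asboolP; exact: entails_mp Ti Tpsi.
Qed.

Theorem theorem18 (A : Type) (A_nonempty : inhabited A) (T0 : theory A) :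
  (generic T0 -> generic (theory_closure T0)) /\
  (closed_generic T0 -> closed_generic (theory_closure T0)).
Proof.
have T0sub T' : theory_closure T0 `<=` T' -> T0 `<=` T'.
  by apply: subset_trans; exact: sub_theory_closure.
split=> [T0gen S T' TT'|T0gen S T' T'cl TT'];
  apply: canonical_model_theory_closure => //.
- by apply: T0gen; exact: T0sub.
- by apply: T0gen => //; exact: T0sub.
Qed.
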